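(* Let $n\in\mathbb{N}$ and let $p,\beta$ be reals with $0<\beta\le\frac{pn}{400}$. Then every $n$-vertex $(p,\beta)$-bijumbled graph with minimum degree at least $4\sqrt{p\beta n}$ is an $(n,d_1)$-expander for $d_1=\frac{pn}{4\beta}$. Moreover, every $(n,d,\lambda)$-graph with $\lambda<\frac{d}{8}$ is an $(n,\frac{d}{2\lambda})$-expander.
   Context: All graphs are finite and simple. A graph $G=(V,E)$ is $(p,\beta)$-bijumbled if for all vertex sets $X,Y\subseteq V$ we have $\bigl|e_G(X,Y)-p|X||Y|\bigr|\le \beta\sqrt{|X||Y|}$, where $e_G(X,Y)$ is the number of pairs $(x,y)\in X\times Y$ with $xy\in E$ (so edges inside $X\cap Y$ are counted twice). For an $n$-vertex graph $G$ let $\lambda_1\ge\dots\ge\lambda_n$ be the eigenvalues of its adjacency matrix, and call $\max_{2\le i\le n}|\lambda_i|$ the second eigenvalue of $G$. An $(n,d,\lambda)$-graph is a $d$-regular graph on $n$ vertices whose second eigenvalue is at most $\lambda$. For $X\subseteq V(G)$, $N_G(X)=\bigl(\bigcup_{v\in X}N_G(v)\bigr)\setminus X$. Given $n\in\mathbb{N}$ and real $d>0$, an $n$-vertex graph $G$ is an $(n,d)$-expander if (i) $|N_G(X)|\ge d|X|$ for all $X\subseteq V(G)$ with $1\le |X|<\frac{n}{2d}$; and (ii) $e_G(X,Y)>0$ for all disjoint $X,Y\subseteq V(G)$ with $|X|=|Y|\ge\frac{n}{2d}$. *)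

(* Defs.v *)
From mathcomp Require Import all_boot all_order all_algebra.
From mathcomp Require Import reals.
From mathcomp Require Import polyrcf.

Set Implicit Arguments.
Unset Strict Implicit.
Unset Printing Implicit Defensive.

Import Order.TTheory GRing.Theory Num.Theory.
Local Open Scope ring_scope.

Record sgraph (T : finType) := SGraph {
  adj :> rel T;
  adj_sym : symmetric adj;
  adj_irrefl : irreflexive adj }.

Section Graph.
Variables (T : finType) (G : sgraph T).

Definition deg (v : T) : nat := #|[set w | G v w]|.

(* Ordered pairs: an edge inside X :&: Y contributes 2. *)
Definition edges_between (X Y : {set T}) : nat :=
  #|[set xy in setX X Y | G xy.1 xy.2]|.

Definition neighbourhood (X : {set T}) : {set T} :=
  (\bigcup_(v in X) [set w | G v w]) :\: X.

Definition regular (d : nat) : Prop := forall v, deg v = d.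

End Graph.

Section RealGraph.
Variable R : realType.

Definition bijumbled (p beta : R) (T : finType) (G : sgraph T) : Prop :=
  forall X Y : {set T},
    `|(edges_between G X Y)%:R - p * #|X|%:R * #|Y|%:R|
      <= beta * Num.sqrt (#|X|%:R * #|Y|%:R).

Definition adj_mx (T : finType) (G : sgraph T) : 'M[R]_#|T| :=
  \matrix_(i, j) (G (enum_val i) (enum_val j))%:R.

(* [rootsR p] lists each real root of p once and [mup x p] is its multiplicity,
   so this is lambda_1 >= lambda_2 >= ... repeated with multiplicity.  No
   eigenvalue is lost by considering only real roots, since adj_mx G is
   symmetric. *)
Definition eigenvalues (T : finType) (G : sgraph T) : seq R :=
  let p := char_poly (adj_mx G) in
  sort >=%R (flatten [seq nseq (mup x p) x | x <- rootsR p]).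

(* max_(2 <= i <= n) |lambda_i|, which is 0 when n <= 1. *)
Definition second_eigenvalue (T : finType) (G : sgraph T) : R :=
  \big[Num.max/0]_(x <- behead (eigenvalues G)) `|x|.

Definition ndl_graph (n d : nat) (lambda : R) (T : finType) (G : sgraph T) :
    Prop :=
  [/\ #|T| = n, regular G d & second_eigenvalue G <= lambda].

Definition expander (n : nat) (d : R) (T : finType) (G : sgraph T) : Prop :=
  [/\ #|T| = n,
      0 < d,
      forall X : {set T}, (1 <= #|X|)%N -> #|X|%:R < n%:R / (2 * d) ->
        d * #|X|%:R <= #|neighbourhood G X|%:R
    & forall X Y : {set T}, [disjoint X & Y] -> #|X| = #|Y| ->
        n%:R / (2 * d) <= #|X|%:R -> (0 < edges_between G X Y)%N].

End RealGraph.

(* Main.v *)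
(* For the (n,d,lambda)-part, the spectral theorem shows that A contracts the
   orthogonal complement of the constant vectors by a factor lambda, so that
   |A 1_X|^2 <= lambda^2 (|X| - |X|^2/n) + d^2 |X|^2/n.  If A 1_X is supported
   on B, then Cauchy-Schwarz bounds (d|X|)^2 by |B| |A 1_X|^2; taking for B the
   set X together with its neighbourhood gives (i) (Tanner's inequality), and
   taking for B the complement of Y gives (ii).
   For the bijumbled part, let Z be the set of vertices outside X and its
   neighbourhood N.  If N is small then |Z| is at least about n/2 and e(X,Z) = 0 forces
   |X| to be O(beta^2/(p^2 n)); for such an X the bijumbled upper bound on
   e(X, X u N) contradicts the minimum degree. *)
Require Import Defs.
From mathcomp Require Import all_boot all_order all_algebra.
From mathcomp Require Import reals.
From mathcomp Require Import polyrcf complex.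
From mathcomp Require Import ring lra.

Set Implicit Arguments.
Unset Strict Implicit.
Unset Printing Implicit Defensive.

Import Order.TTheory GRing.Theory Num.Theory.
Local Open Scope ring_scope.
Local Open Scope sesquilinear_scope.

(** * Spectral theory of real symmetric matrices *)

Lemma char_poly_conjugate (F : fieldType) (n : nat) (P A : 'M[F]_n) :
  P \in unitmx -> char_poly (invmx P *m A *m P) = char_poly A.
Proof.
move=> P_unit.
pose Pp : 'M[{poly F}]_n := map_mx polyC P.
pose Qp : 'M[{poly F}]_n := map_mx polyC (invmx P).
have QP : Qp *m Pp = 1%:M by rewrite -map_mxM mulVmx // map_mx1.
have eqQAP : char_poly_mx (invmx P *m A *m P) = Qp *m char_poly_mx A *m Pp.
  rewrite /char_poly_mx mulmxBr mulmxBl !map_mxM mul_mx_scalar -scalemxAl QP.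
  by rewrite scalemx1.
by rewrite /char_poly eqQAP !det_mulmx mulrAC -det_mulmx QP det1 mul1r.
Qed.

(** The complexification of [A] is Hermitian, so it is unitarily diagonalizable with real
    eigenvalues, which gives [D] over [R]. The factorization of [char_poly A] holds over [R[i]] and
    descends because the embedding of [R] is injective on polynomials. *)
Lemma real_symmetric_spectral (R : rcfType) (n : nat) (A : 'M[R]_n) :
  A^T = A ->
  exists (P : 'M[R[i]]_n) (D : 'rV[R]_n),
    [/\ P \is unitarymx,
        map_mx (real_complex R) A
          = P^t* *m diag_mx (map_mx (real_complex R) D) *m P
      & char_poly A = \prod_j ('X - (D 0 j)%:P)].
Proof.
move=> A_sym; set f := real_complex R; set AC := map_mx f A.
have AC_herm : AC \is hermsymmx.
  apply: realsym_hermsym.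
    by apply/is_hermitianmxP; rewrite expr0 scale1r map_mx_id // map_trmx A_sym.
  by apply/mxOverP => i j; rewrite mxE complex_real.
have P_unit := spectral_unitarymx AC.
have ACE := orthomx_spectralP (hermitian_normalmx AC_herm).
set P := spectralmx AC in P_unit ACE.
pose D := map_mx (@complex.Re R) (spectral_diag AC).
have DE : spectral_diag AC = map_mx f D.
  apply/matrixP => i j; rewrite !mxE /f.
  have /mxOverP/(_ i j) := hermitian_spectral_diag_real AC_herm.
  by move/RRe_real.
exists P, D; split=> //; first by rewrite {1}ACE DE invmx_unitary.
apply: (map_poly_inj f); rewrite map_char_poly -/AC ACE.
rewrite char_poly_conjugate ?unitarymx_unit // DE.
rewrite char_poly_trig; last exact/diag_mx_is_trig.
rewrite rmorph_prod; apply: eq_bigr => j _.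
by rewrite rmorphB /= map_polyX map_polyC !mxE eqxx.
Qed.

(** Identifies the spectrum read off the characteristic polynomial with the diagonal given by the
    spectral theorem: every [y] occurs in both lists as often as its multiplicity in [p]. *)
Lemma perm_roots_mup (R : rcfType) (s : seq R) :
  forall p, p = \prod_(x <- s) ('X - x%:P) ->
  perm_eq (flatten [seq nseq (mup x p) x | x <- rootsR p]) s.
Proof.
move=> p pE; have p_neq0 : p != 0 by rewrite pE monic_neq0 ?monic_prod_XsubC.
rewrite /perm_eq; apply/allP => y _; apply/eqP.
rewrite count_flatten sumnE !big_map.
have -> : count_mem y s = mup y p by rewrite pE mu_prod_XsubC.
have nseqE x : count_mem y (nseq (mup x p) x) = ((x == y) * mup x p)%N.
  by rewrite count_nseq.
rewrite (eq_bigr _ (fun x _ => nseqE x)).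
have [y_root | /negPf y_nroot] := boolP (y \in rootsR p).
  rewrite (bigD1_seq y) ?uniq_roots //= eqxx mul1n big1 ?addn0 // => x.
  by move/negPf => ->.
rewrite big_seq big1 => [|x x_root]; last first.
  by case: eqVneq => // xy; rewrite xy y_nroot in x_root.
rewrite mupNroot //; move: (roots_on_rootsR p_neq0 y).
by rewrite y_nroot in_itv /= => ->.
Qed.

(* [second_eigenvalue G] is convertible to [max_tail_abs] of the unsorted
   spectrum of [adj_mx R G]. *)
Definition max_tail_abs (R : realDomainType) (s : seq R) : R :=
  \big[Num.max/0]_(x <- behead (sort >=%R s)) `|x|.

(** The exceptional index [i] is one whose value heads the sorted list. Only one occurrence is
    dropped, so another index carrying the same largest value still obeys the bound. *)
Lemma max_tail_abs_codom (R : realDomainType) (n : nat) (D : 'I_n -> R)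
    (s : seq R) (lambda : R) :
  perm_eq s [seq D j | j <- enum 'I_n] -> max_tail_abs s <= lambda ->
  (0 < n)%N -> exists i, forall j, j != i -> `|D j| <= lambda.
Proof.
move=> sD; rewrite /max_tail_abs => tail_le n_gt0.
have {sD} : perm_eq (sort >=%R s) [seq D j | j <- enum 'I_n].
  by rewrite perm_sort.
case: (sort _ s) tail_le => [|x t] /= tail_le xtD.
  have := perm_size xtD; rewrite size_map size_enum_ord => n0.
  by rewrite -n0 in n_gt0.
have /mapP[i _ xi] : x \in [seq D j | j <- enum 'I_n].
  by rewrite -(perm_mem xtD) mem_head.
exists i => j ji; apply: le_trans tail_le.
have tD : perm_eq t [seq D j | j <- rem i (enum 'I_n)].
  rewrite -(perm_cons x) (perm_trans xtD) // xi -(map_cons D).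
  by rewrite perm_map // perm_to_rem // mem_enum.
have Dj_t : D j \in t.
  by rewrite (perm_mem tD) map_f // mem_rem_uniq ?enum_uniq // inE ji mem_enum.
by exact: (le_bigmax_seq 0 (D j) xpredT Num.norm).
Qed.

(** All eigenvalues but the one at some index [i0] are at most [lambda < d] in absolute value, so
    the [d]-eigenvector [e] is supported on [i0] in the eigenbasis. A vector orthogonal to [e] then
    has no [i0] coordinate, and [A] scales each other coordinate by at most [lambda]. *)
Lemma spectral_gap_bound (R : rcfType) (n : nat) (A : 'M[R]_n)
    (e v : 'rV[R]_n) (d lambda : R) :
  let p := char_poly A in
  A^T = A -> e *m A = d *: e -> e != 0 -> lambda < d ->
  max_tail_abs (flatten [seq nseq (mup x p) x | x <- rootsR p]) <= lambda ->
  v *m e^T = 0 ->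
  \sum_j (v *m A) 0 j ^+ 2 <= lambda ^+ 2 * \sum_j v 0 j ^+ 2.
Proof.
move=> p A_sym eA e_neq0 lt_ld tail_le ve0.
have [P [D [P_unit ACE pE]]] := real_symmetric_spectral A_sym.
have n_gt0 : (0 < n)%N.
  by case: n e e_neq0 {v ve0 A p A_sym eA tail_le P D P_unit ACE pE} => // e;
    rewrite thinmx0 eqxx.
have [i0 Di0] : exists i, forall j, j != i -> `|D 0 j| <= lambda.
  apply: max_tail_abs_codom tail_le n_gt0.
  by apply: perm_roots_mup; rewrite big_map big_enum.
set f := real_complex R in ACE.
(* Coordinates of [u] in the orthonormal eigenbasis formed by the rows of [P]; [w_dot] is Parseval's
   identity. *)
pose w (u : 'rV[R]_n) := map_mx f u *m P^t*.
have w_dot u u' : f ((u *m u'^T) 0 0) = \sum_j w u 0 j * (w u' 0 j)^*.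
  transitivity ((w u *m (w u')^t*) 0 0); last first.
    by rewrite mxE; apply: eq_bigr => j _; rewrite !mxE.
  rewrite /w trmx_mul map_mxM trmxCK mulmxA mulmxKtV //.
  have -> : (map_mx f u')^t* = map_mx f u'^T.
    apply/matrixP => i j; rewrite !mxE.
    by apply/CrealP; rewrite complex_real.
  by rewrite -map_mxM [RHS]mxE.
have w_sqr (u : 'rV[R]_n) : f (\sum_j u 0 j ^+ 2) = \sum_j `|w u 0 j| ^+ 2.
  have -> : \sum_j u 0 j ^+ 2 = (u *m u^T) 0 0.
    by rewrite mxE; apply: eq_bigr => j _; rewrite mxE expr2.
  by rewrite w_dot; apply: eq_bigr => j _; rewrite normCK.
have wA u j : w (u *m A) 0 j = w u 0 j * f (D 0 j).
  rewrite /w map_mxM ACE !mulmxA mulmxtVK //.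
  by rewrite mul_mx_diag mxE [map_mx f D 0 j]mxE.
(* Comparing coordinates in [e *m A = d *: e], a nonzero coordinate at [j] forces [D 0 j = d], which
   exceeds [lambda]. *)
have we0 j : j != i0 -> w e 0 j = 0.
  move=> /Di0 Dj_le; apply/eqP; apply: contraTT lt_ld => wej; rewrite -leNgt.
  have := wA e j; rewrite eA /w map_mxZ -scalemxAl mxE -/(w e) mulrC.
  by move=> /(mulfI wej)/complexI ->; rewrite (le_trans (ler_norm _)).
have wei0 : w e 0 i0 != 0.
  apply: contra e_neq0 => /eqP we_i0.
  have we : w e = 0.
    apply/matrixP => i j; rewrite ord1 [RHS]mxE.
    by have [->|/we0] := eqVneq j i0.
  have : map_mx f e = 0.
    rewrite -[map_mx f e]mulmx1 -(mulVmx (unitarymx_unit P_unit)).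
    by rewrite invmx_unitary // mulmxA -/(w e) we mul0mx.
  by move/eqP; rewrite map_mx_eq0.
have wvi0 : w v 0 i0 = 0.
  have := w_dot v e; rewrite ve0 mxE /f rmorph0 (bigD1 i0) //= big1 => [|j /we0 ->].
    rewrite addr0 => /esym/eqP; rewrite mulf_eq0 conjC_eq0 (negPf wei0) orbF.
    by move/eqP.
  by rewrite conjC0 mulr0.
rewrite -lecR rmorphM /= -/f !w_sqr mulr_sumr.
apply: ler_sum => j _; rewrite wA normrM exprMn mulrC.
have [->|/Di0 Dj_le] := eqVneq j i0; first by rewrite wvi0 normr0 expr0n !mulr0.
rewrite ler_wpM2r ?exprn_ge0 //.
rewrite -normrX ger0_norm ?rmorphXn; last first.
  by rewrite -rmorphXn /= ler0c sqr_ge0.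
rewrite -!rmorphXn lecR -real_normK ?num_real //.
by rewrite lerXn2r // nnegrE ?(le_trans _ Dj_le).
Qed.

(** * Edge and degree counts *)

Section GraphCounting.
Variables (T : finType) (G : sgraph T).
Implicit Types X Y : {set T}.

(** The entry at [y] of the vector $A 1_X$. *)
Definition deg_in X (y : T) : nat := \sum_(x in X) G y x.

Lemma deg_sum v : deg G v = (\sum_w G v w)%N.
Proof.
by rewrite /deg -sum1dep_card big_mkcond; apply: eq_bigr => w _; case: (G v w).
Qed.

Lemma edges_between_sum X Y :
  edges_between G X Y = (\sum_(x in X) \sum_(y in Y) G x y)%N.
Proof.
rewrite /edges_between -sum1dep_card pair_big big_mkcond [RHS]big_mkcond /=.
apply: eq_bigr => [[x y]] _ /=; rewrite inE /=.
by case: (x \in X) (y \in Y) (G x y) => [] [] [].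
Qed.

Lemma sum_deg_in X : (\sum_y deg_in X y = \sum_(x in X) deg G x)%N.
Proof.
rewrite exchange_big; apply: eq_bigr => x _.
by rewrite deg_sum; apply: eq_bigr => y _; rewrite adj_sym.
Qed.

Lemma card_setU_neighbourhood X :
  #|X :|: neighbourhood G X| = (#|X| + #|neighbourhood G X|)%N.
Proof.
by rewrite cardsU; rewrite /neighbourhood setIDA setDIl setDv set0I cards0 subn0.
Qed.

Lemma adj_setU_neighbourhood X x y :
  x \in X -> G x y -> y \in X :|: neighbourhood G X.
Proof.
move=> xX Gxy; rewrite !inE; case: (y \in X) => //=.
by apply/bigcupP; exists x; rewrite ?inE.
Qed.

Lemma edges_between_neighbourhood X :
  edges_between G X (X :|: neighbourhood G X) = (\sum_(x in X) deg G x)%N.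
Proof.
rewrite edges_between_sum; apply: eq_bigr => x xX.
rewrite deg_sum big_mkcond; apply: eq_bigr => y _.
case: ifPn => // yN; case: (boolP (G x y)) => // Gxy.
by rewrite (adj_setU_neighbourhood xX Gxy) in yN.
Qed.

Lemma edges_between_neighbourhoodC X :
  edges_between G X (~: (X :|: neighbourhood G X)) = 0%N.
Proof.
rewrite edges_between_sum big1 // => x xX; rewrite big1 // => y.
rewrite inE => yN; case: (boolP (G x y)) => // Gxy.
by rewrite (adj_setU_neighbourhood xX Gxy) in yN.
Qed.

Lemma deg_in_neighbourhoodC X y :
  y \notin X :|: neighbourhood G X -> deg_in X y = 0%N.
Proof.
move=> yN; rewrite /deg_in big1 // => x xX; rewrite adj_sym.
case: (boolP (G x y)) => // Gxy.
by rewrite (adj_setU_neighbourhood xX Gxy) in yN.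
Qed.

Lemma deg_in_edges0 X Y y :
  edges_between G X Y = 0%N -> y \in Y -> deg_in X y = 0%N.
Proof.
rewrite edges_between_sum exchange_big /= => /eqP.
rewrite sum_nat_eq0 => /forall_inP e0 /e0/eqP <-.
by apply: eq_bigr => x _; rewrite adj_sym.
Qed.

End GraphCounting.

(** * Expansion of graphs with a spectral gap *)

Lemma sqr_sum_le_support (R : realFieldType) (I : finType) (B : {set I})
    (g : I -> R) :
  (forall i, i \notin B -> g i = 0) ->
  (\sum_i g i) ^+ 2 <= #|B|%:R * \sum_i g i ^+ 2.
Proof.
move=> g0; set S := \sum_i g i; set Q := \sum_i _; set b : R := #|B|%:R.
have SB : S = \sum_(i in B) g i.
  by rewrite [RHS]big_mkcond; apply: eq_bigr => i _; case: ifPn => // /g0.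
have QB : Q = \sum_(i in B) g i ^+ 2.
  rewrite [RHS]big_mkcond; apply: eq_bigr => i _.
  by case: ifPn => // /g0 ->; rewrite expr0n.
(* Cauchy-Schwarz against the indicator of [B], as nonnegativity of a rescaled variance of [g] on
   [B]. The common factor [b] is cancelled below, so empty [B] is treated apart. *)
have : 0 <= \sum_(i in B) (b * g i - S) ^+ 2.
  by rewrite sumr_ge0 // => i _; apply: sqr_ge0.
have -> : \sum_(i in B) (b * g i - S) ^+ 2 = b * (b * Q - S ^+ 2).
  transitivity (\sum_(i in B) (b ^+ 2 * g i ^+ 2 - 2 * b * S * g i + S ^+ 2)).
    by apply: eq_bigr => i _; ring.
  rewrite big_split /= sumr_const sumrB -!mulr_sumr -SB -QB -mulr_natl -/b.
  by ring.
have [B0|B_gt0] := posnP #|B|; last by rewrite pmulr_rge0 ?ltr0n // subr_ge0.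
by move=> _; rewrite SB QB (cards0_eq B0) !big_set0 expr0n mulr0.
Qed.

Lemma sum_enum_val (R : nmodType) (T : finType) (F : T -> R) :
  \sum_(j < #|T|) F (enum_val j) = \sum_x F x.
Proof. rewrite [RHS](reindex (@enum_val T T)) //.
exact/onW_bij/enum_val_bij. Qed.

(** Write $1_X = v + c 1$ with $c = |X|/n$, so that $v$ is orthogonal to the constants. Then $A 1_X
    = A v + c d 1$ is an orthogonal sum, and the two terms of the bound are those for $|A v|^2$ and
    $|c d 1|^2$. *)
Lemma ndl_sum_sqr_deg_in (R : realType) (n d : nat) (lambda : R) (T : finType)
    (G : sgraph T) (X : {set T}) :
  (0 < n)%N -> ndl_graph n d lambda G -> lambda < d%:R ->
  \sum_y (deg_in G X y)%:R ^+ 2 <=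
    lambda ^+ 2 * (#|X|%:R - #|X|%:R ^+ 2 / n%:R)
    + d%:R ^+ 2 * #|X|%:R ^+ 2 / n%:R.
Proof.
move=> n_gt0 [cardT reg_d second_le] lt_ld.
have n_neq0 : n%:R != 0 :> R by rewrite pnatr_eq0 -lt0n.
set x : R := #|X|%:R; pose c := x / n%:R.
pose A := adj_mx R G; pose e : 'rV[R]_#|T| := const_mx 1.
pose v : 'rV[R]_#|T| := \row_j ((enum_val j \in X)%:R - c).
have A_sym : A^T = A by apply/matrixP => i j; rewrite !mxE adj_sym.
have sum_adj y : \sum_x (G x y)%:R = d%:R :> R.
  rewrite -natr_sum -(reg_d y) deg_sum; congr (_%:R).
  by apply: eq_bigr => z _; rewrite adj_sym.
have sum_X : \sum_y (y \in X)%:R = x.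
  by rewrite -natr_sum /x -sum1_card [in RHS]big_mkcond.
have eA : e *m A = d%:R *: e.
  apply/matrixP => i j; rewrite !mxE mulr1 -(sum_adj (enum_val j)).
  rewrite -(sum_enum_val (fun x => (G x (enum_val j))%:R)).
  by apply: eq_bigr => k _; rewrite !mxE mul1r.
have sum_cst (a : R) : \sum_(y : T) a = n%:R * a.
  by rewrite sumr_const cardT mulr_natl.
have e_neq0 : e != 0.
  rewrite -cardT in n_gt0; apply/eqP => /matrixP/(_ 0 (Ordinal n_gt0)).
  by rewrite !mxE => /eqP; rewrite oner_eq0.
have ve : v *m e^T = 0.
  apply/matrixP => i j; rewrite !mxE.
  transitivity (\sum_(k < #|T|) ((enum_val k \in X)%:R - c)).
    by apply: eq_bigr => k _; rewrite !mxE mulr1.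
  rewrite (sum_enum_val (fun y => (y \in X)%:R - c)) sumrB sum_X sum_cst /c.
  by rewrite mulrCA divff // mulr1 subrr.
have vA j : (v *m A) 0 j = (deg_in G X (enum_val j))%:R - c * d%:R.
  rewrite mxE.
  transitivity (\sum_(k < #|T|)
      ((enum_val k \in X)%:R - c) * (G (enum_val k) (enum_val j))%:R).
    by apply: eq_bigr => k _; rewrite !mxE.
  rewrite (sum_enum_val (fun y => ((y \in X)%:R - c) * (G y (enum_val j))%:R)).
  rewrite -(sum_adj (enum_val j)) mulr_sumr natr_sum [X in X - _]big_mkcond -sumrB.
  apply: eq_bigr => y _; rewrite mulrBl adj_sym; congr (_ - _).
  by case: (y \in X); rewrite ?mul1r ?mul0r.
have := spectral_gap_bound A_sym eA e_neq0 lt_ld second_le ve.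
have -> : \sum_j v 0 j ^+ 2 = x - x ^+ 2 / n%:R.
  transitivity (\sum_(k < #|T|) ((enum_val k \in X)%:R - c) ^+ 2).
    by apply: eq_bigr => k _; rewrite !mxE.
  rewrite (sum_enum_val (fun y => ((y \in X)%:R - c) ^+ 2)).
  transitivity (\sum_y ((1 - 2 * c) * (y \in X)%:R + c ^+ 2)).
    by apply: eq_bigr => y _; case: (y \in X); rewrite /=; ring.
  by rewrite big_split -mulr_sumr sum_X sum_cst /c /=; field.
have -> : \sum_j (v *m A) 0 j ^+ 2
    = \sum_y (deg_in G X y)%:R ^+ 2 - d%:R ^+ 2 * x ^+ 2 / n%:R.
  transitivity (\sum_(k < #|T|) ((deg_in G X (enum_val k))%:R - c * d%:R) ^+ 2).
    by apply: eq_bigr => k _; rewrite vA.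
  rewrite (sum_enum_val (fun y => ((deg_in G X y)%:R - c * d%:R) ^+ 2)).
  transitivity (\sum_y ((deg_in G X y)%:R ^+ 2 - 2 * c * d%:R * (deg_in G X y)%:R
                        + (c * d%:R) ^+ 2)).
    by apply: eq_bigr => y _; ring.
  (* By double counting the [deg_in] sum to $d|X|$, so the linear and constant terms combine to
     $-d^2|X|^2/n$. *)
  rewrite big_split sumrB -mulr_sumr sum_cst -natr_sum sum_deg_in.
  rewrite (eq_bigr (fun _ => d)) => [|y _]; last exact: reg_d.
  by rewrite sum_nat_const natrM -/x /c /=; field.
by rewrite lerBlDr.
Qed.

Lemma ndl_support_bound (R : realType) (n d : nat) (lambda : R) (T : finType)
    (G : sgraph T) (X B : {set T}) :
  (0 < n)%N -> ndl_graph n d lambda G -> lambda < d%:R -> (0 < #|X|)%N ->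
  (forall y, y \notin B -> deg_in G X y = 0%N) ->
  d%:R ^+ 2 * #|X|%:R * n%:R <=
    #|B|%:R * (lambda ^+ 2 * (n%:R - #|X|%:R) + d%:R ^+ 2 * #|X|%:R).
Proof.
move=> n_gt0 ndlG lt_ld X_gt0 deg0.
have nR_gt0 : 0 < n%:R :> R by rewrite ltr0n.
have xR_gt0 : 0 < #|X|%:R :> R by rewrite ltr0n.
have := @sqr_sum_le_support R T B (fun y => (deg_in G X y)%:R) _.
have [_ reg_d _] := ndlG.
rewrite -natr_sum sum_deg_in (eq_bigr (fun _ => d)) => [|y _]; last exact: reg_d.
rewrite sum_nat_const natrM => /(_ _) sqr_le.
have {}sqr_le : (#|X|%:R * d%:R) ^+ 2
    <= #|B|%:R * \sum_y (deg_in G X y)%:R ^+ 2 :> R.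
  by apply: sqr_le => y /deg0 ->.
have {sqr_le} := le_trans sqr_le
  (ler_wpM2l (ler0n R #|B|) (ndl_sum_sqr_deg_in X n_gt0 ndlG lt_ld)).
(* Scaled by $|X|/n$, the goal is exactly the Cauchy-Schwarz bound just obtained. *)
rewrite -(ler_pM2l (divr_gt0 xR_gt0 nR_gt0)).
set x : R := #|X|%:R in xR_gt0 *; set b : R := #|B|%:R.
have x_neq0 : x != 0 by rewrite gt_eqF.
have n_neq0 : n%:R != 0 :> R by rewrite gt_eqF.
move=> le_xb; apply: etrans le_xb.
by congr (_ <= _); field.
Qed.

(* With [lambda = 0], the support bound for a single vertex [x] and
   [B = ~: [set x]] would read [d^2 n <= (n - 1) d^2]. *)
Lemma ndl_lambda_gt0 (R : realType) (n d : nat) (lambda : R) (T : finType)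
    (G : sgraph T) :
  (0 < n)%N -> ndl_graph n d lambda G -> lambda < d%:R / 8 -> 0 < lambda.
Proof.
move=> n_gt0 ndlG lt_ld; have [cardT reg_d second_le] := ndlG.
(* The maximum defining [second_eigenvalue] starts from the default 0. *)
have l_ge0 : 0 <= lambda.
  apply: le_trans second_le; rewrite /second_eigenvalue.
  by elim/big_ind: _ => // a b a_ge0 b_ge0; rewrite le_max a_ge0.
rewrite lt_neqAle l_ge0 andbT eq_sym; apply/eqP => l0.
have d_gt0 : 0 < d%:R :> R by move: lt_ld; rewrite l0; lra.
have [x xT] : exists x, x \in T by apply/card_gt0P; rewrite cardT.
have := @ndl_support_bound R n d lambda T G [set x] (~: [set x]) n_gt0 ndlG.
rewrite cards1 l0 => /(_ d_gt0 isT) bound.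
have {bound} : d%:R ^+ 2 * 1 * n%:R <= #|~: [set x]|%:R *
    (0 ^+ 2 * (n%:R - 1) + d%:R ^+ 2 * 1) :> R.
  apply: bound => y; rewrite !inE negbK => /eqP ->.
  by rewrite /deg_in big_set1 adj_irrefl.
have -> : #|~: [set x]|%:R = n%:R - 1 :> R.
  by rewrite cardsC1 cardT -subn1 natrB.
have : 0 < d%:R ^+ 2 :> R by rewrite exprn_gt0.
by nra.
Qed.

Lemma ndl_expander (R : realType) (n d : nat) (lambda : R) (T : finType)
    (G : sgraph T) :
  (0 < n)%N -> ndl_graph n d lambda G -> lambda < d%:R / 8 ->
  expander n (d%:R / (2 * lambda)) G.
Proof.
move=> n_gt0 ndlG lt_ld8; have l_gt0 := ndl_lambda_gt0 n_gt0 ndlG lt_ld8.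
have d_gt0 : 0 < d%:R :> R by lra.
have lt_ld : lambda < d%:R by lra.
have nR_gt0 : 0 < n%:R :> R by rewrite ltr0n.
have bound := ndl_support_bound n_gt0 ndlG lt_ld.
have cutE : n%:R / (2 * (d%:R / (2 * lambda))) = n%:R * lambda / d%:R.
  by field; rewrite !gt_eqF.
have [cardT _ _] := ndlG.
split=> //; rewrite ?cutE; first by rewrite divr_gt0 ?mulr_gt0.
- move=> X X_gt0; rewrite ltr_pdivlMr // mulrAC ler_pdivrMr ?mulr_gt0 // => X_lt.
  have := bound X (X :|: neighbourhood G X) X_gt0 (@deg_in_neighbourhoodC _ _ _).
  have xR_gt0 : 0 < #|X|%:R :> R by rewrite ltr0n.
  rewrite card_setU_neighbourhood natrD.
  set x : R := #|X|%:R in X_lt xR_gt0 *; set m : R := #|neighbourhood G X|%:R.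
  set D : R := d%:R in lt_ld8 d_gt0 lt_ld X_lt *.
  set N : R := n%:R in nR_gt0 X_lt *.
  move=> le_xn; rewrite leNgt; apply/negP => m_lt.
  have xm_gt0 : 0 < x + m by rewrite ltr_wpDr ?ler0n.
  (* As [lambda < D], the bracket increases with [x]. At the threshold $x = N\lambda/D$ it equals
     $N\lambda(\lambda+D) - N\lambda^3/D$, whose last term is dropped. *)
  have gap : D * (lambda ^+ 2 * (N - x) + D ^+ 2 * x)
      <= D * (N * lambda * (lambda + D)).
    rewrite -subr_ge0.
    have -> : D * (N * lambda * (lambda + D)) - D * (lambda ^+ 2 * (N - x) + D ^+ 2 * x)
      = (D ^+ 2 - lambda ^+ 2) * (N * lambda - x * D) + lambda ^+ 3 * N by ring.
    rewrite addr_ge0 ?mulr_ge0 ?exprn_ge0 ?ltW // subr_gt0 //.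
    by rewrite ltr_pXn2r // nnegrE ltW.
  rewrite ler_pM2l // in gap.
  have : D ^+ 2 * x * N <= (x + m) * lambda * (lambda + D) * N.
    apply: le_trans le_xn _.
    have -> : (x + m) * lambda * (lambda + D) * N = (x + m) * (N * lambda * (lambda + D)).
      by ring.
    by rewrite ler_pM2l.
  rewrite ler_pM2r // => le_x.
  (* Insert $m < Dx/(2\lambda)$ in [le_x]. Since $\lambda < D/8$, the right side is below
     $(5/4)(9/8)D^2 < 2D^2$, a contradiction. *)
  have : D ^+ 2 * 2 < (2 * lambda + D) * (lambda + D).
    rewrite -(ltr_pM2r xR_gt0).
    have : (2 * x * lambda + 2 * m * lambda) * (lambda + D)
        < (2 * x * lambda + D * x) * (lambda + D).
      by rewrite ltr_pM2r ?addr_gt0 // ltrD2l; lra.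
    by nra.
  by nra.
move=> X Y XY_disj cardXY; rewrite ler_pdivrMr // => X_ge.
have xR_gt0 : 0 < #|X|%:R :> R.
  by have : 0 < #|X|%:R * d%:R :> R; [exact: lt_le_trans (mulr_gt0 _ _) X_ge|
    rewrite pmulr_lgt0].
rewrite lt0n; apply/eqP => e0.
have X_gt0 : (0 < #|X|)%N by rewrite -(ltr0n R).
have degY0 y : y \notin ~: Y -> deg_in G X y = 0%N.
  by rewrite inE negbK; apply: deg_in_edges0.
have := bound X (~: Y) X_gt0 degY0.
have x_le : #|X|%:R <= n%:R :> R by rewrite ler_nat -cardT max_card.
have -> : #|~: Y|%:R = n%:R - #|X|%:R :> R.
  by rewrite cardXY -cardT -(cardsC Y) natrD addrAC subrr add0r.
set x : R := #|X|%:R in X_ge xR_gt0 x_le *.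
set D : R := d%:R in lt_ld8 d_gt0 lt_ld X_ge *.
set N : R := n%:R in nR_gt0 X_ge x_le *.
move=> le_xn.
(* Moving the term $D^2 x (N - x)$ of [le_xn] to the left leaves $D^2x^2$ there. The square root of
   the result contradicts $N\lambda \le xD$. *)
have le1 : (x * D) ^+ 2 <= (lambda * (N - x)) ^+ 2 by lra.
have le2 : x * D <= lambda * (N - x).
  by move: le1; rewrite ler_pXn2r // nnegrE ?mulr_ge0 ?subr_ge0 // ltW.
by have : 0 < lambda * x; [rewrite mulr_gt0 | lra].
Qed.

(** * Expansion of bijumbled graphs *)

Lemma bijumbled_expander (R : realType) (n : nat) (p beta : R) (T : finType)
    (G : sgraph T) :
  (0 < n)%N -> 0 < beta -> beta <= p * n%:R / 400 -> #|T| = n ->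
  bijumbled p beta G ->
  (forall v : T, 4 * Num.sqrt (p * beta * n%:R) <= (deg G v)%:R) ->
  expander n (p * n%:R / (4 * beta)) G.
Proof.
move=> n_gt0 b_gt0 b_le cardT jumbled deg_ge.
have nR_gt0 : 0 < n%:R :> R by rewrite ltr0n.
have k_gt0 : 0 < p * n%:R by lra.
have p_gt0 : 0 < p by rewrite -(pmulr_lgt0 p nR_gt0).
have cutE : n%:R / (2 * (p * n%:R / (4 * beta))) = 2 * beta / p.
  by field; rewrite !gt_eqF.
split=> //; rewrite ?cutE; first by rewrite divr_gt0 ?mulr_gt0.
- move=> X X_gt0; rewrite ltr_pdivlMr // mulrAC ler_pdivrMr ?mulr_gt0 // => X_lt.
  have xR_gt0 : 0 < #|X|%:R :> R by rewrite ltr0n.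
  have := jumbled X (X :|: neighbourhood G X).
  have := jumbled X (~: (X :|: neighbourhood G X)).
  rewrite edges_between_neighbourhoodC edges_between_neighbourhood.
  have -> : #|~: (X :|: neighbourhood G X)|%:R
      = n%:R - #|X|%:R - #|neighbourhood G X|%:R :> R.
    rewrite -addrA -opprD -natrD -card_setU_neighbourhood -cardT.
    by rewrite -(cardsC (X :|: neighbourhood G X)) natrD addrAC subrr add0r.
  rewrite card_setU_neighbourhood [(_ + _)%:R]natrD.
  have : #|X|%:R * (4 * Num.sqrt (p * beta * n%:R))
      <= (\sum_(x in X) deg G x)%N%:R.
    rewrite natr_sum mulr_natl -sumr_const; apply: ler_sum => x _.
    exact: deg_ge.
  move: (\sum_(x in X) deg G x)%N => e.
  set s := Num.sqrt (p * beta * n%:R).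
  have s_ge0 : 0 <= s by exact: sqrtr_ge0.
  have s2 : s ^+ 2 = p * n%:R * beta.
    by rewrite sqr_sqrtr ?mulr_ge0 ?ltW //; ring.
  set x : R := #|X|%:R in X_lt xR_gt0 *; set m : R := #|neighbourhood G X|%:R.
  have m_ge0 : 0 <= m by exact: ler0n.
  set k := p * n%:R in k_gt0 b_le s2 *.
  set z : R := n%:R - x - m.
  have pzE : p * z = k - p * x - p * m by rewrite /z /k; ring.
  move=> e_ge; rewrite sub0r normrN => le_z; rewrite ler_norml => /andP[_ e_le].
  rewrite leNgt; apply/negP => m_lt.
  have pm_lt : p * m < k / 2.
    have : (p * m) * (4 * beta) < (k / 2) * (4 * beta).
      have : p * (m * (4 * beta)) < p * (k * x) by rewrite ltr_pM2l.
      have : k * (x * p) < k * (2 * beta) by rewrite ltr_pM2l.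
      by lra.
    by rewrite ltr_pM2r // mulr_gt0.
  (* Here $px < 2\beta \le k/200$ and $pm < k/2$, which leaves $k(1 - 1/200 - 1/2)$. *)
  have pz_gt : k * (99 / 200) < p * z by lra.
  have z_gt0 : 0 < z by rewrite -(pmulr_rgt0 z p_gt0); lra.
  (* No edge joins [X] to the remaining [z] vertices, so $pxz \le \beta\sqrt{xz}$; square and cancel
     $xz$. *)
  have xz_small : p * x * (p * z) <= beta ^+ 2.
    have xz_gt0 : 0 < x * z by rewrite mulr_gt0.
    have q2 : Num.sqrt (x * z) ^+ 2 = x * z by rewrite sqr_sqrtr // ltW.
    have : (p * x * z) ^+ 2 <= (beta * Num.sqrt (x * z)) ^+ 2.
      by rewrite lerXn2r ?(le_trans (ler_norm _) le_z) // nnegrE ?mulr_ge0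
        ?sqrtr_ge0 // ltW.
    rewrite !exprMn q2 => le_sq.
    by rewrite -(ler_pM2r xz_gt0); lra.
  have pxk : p * x * k * (99 / 200) <= beta ^+ 2.
    apply: le_trans xz_small; rewrite -mulrA ler_pM2l ?mulr_gt0 //; lra.
  (* The extra hundredth is $4\beta x \le kx/100$. *)
  have xm_small : (x + m) * (4 * beta) <= k * x * (101 / 100) by nra.
  (* By [xm_small] and [pxk] the constant is $(101/400)(200/99) < 1$. *)
  have term1 : p * x * (x + m) <= beta * x.
    have : p * x * ((x + m) * (4 * beta)) <= p * x * (k * x * (101 / 100)).
      by rewrite ler_pM2l ?mulr_gt0.
    have : p * x * k * (99 / 200) * x <= beta ^+ 2 * x by rewrite ler_pM2r.
    have : 0 < beta ^+ 2 * x by rewrite mulr_gt0 ?exprn_gt0.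
    move=> h1 h2 h3.
    have : p * x * (x + m) * (4 * beta) <= beta * x * (4 * beta) by lra.
    by rewrite ler_pM2r // mulr_gt0.
  have beta_s : beta <= s.
    rewrite -(@ler_pXn2r _ 2) ?nnegrE ?(ltW b_gt0) // s2 expr2 ler_pM2r //.
    by lra.
  have s_gt0 : 0 < s by lra.
  have term2 : beta * Num.sqrt (x * (x + m)) <= s * x.
    have xm_ge0 : 0 <= x * (x + m) by rewrite mulr_ge0 ?addr_ge0 ?(ltW xR_gt0).
    rewrite -(@ler_pXn2r _ 2) ?nnegrE ?mulr_ge0 ?sqrtr_ge0 ?(ltW xR_gt0)
      ?(ltW b_gt0) //.
    rewrite !exprMn sqr_sqrtr // s2.
    have : beta * x * ((x + m) * (4 * beta)) <= beta * x * (k * x * (101 / 100)).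
      by rewrite ler_pM2l ?mulr_gt0.
    have : 0 < beta * x * (k * x) by rewrite !mulr_gt0.
    by lra.
  (* The minimum degree gives $4sx \le e$, whereas [term1] and [term2] give $e \le \beta x + sx \le
     2sx$. *)
  have : beta * x <= s * x by rewrite ler_pM2r.
  have : 0 < s * x by rewrite mulr_gt0.
  by lra.
move=> X Y _ cardXY; rewrite ler_pdivrMr // => X_ge.
have xR_gt0 : 0 < #|X|%:R :> R by rewrite -(pmulr_lgt0 _ p_gt0); lra.
rewrite lt0n; apply/eqP => e0.
(* Without edges, $p|X|^2 \le \beta|X|$, against $p|X| \ge 2\beta$. *)
have := jumbled X Y; rewrite e0 -cardXY sub0r normrN -expr2 sqrtr_sqr.
rewrite (ger0_norm (ltW xR_gt0)) => /(le_trans (ler_norm _)).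
by rewrite ler_pM2r //; lra.
Qed.

Theorem proposition1p12 (R : realType) (n : nat) (n_gt0 : (0 < n)%N) :
  (forall p beta : R, 0 < beta -> beta <= p * n%:R / 400 ->
     forall (T : finType) (G : sgraph T), #|T| = n ->
       bijumbled p beta G ->
       (forall v : T, 4 * Num.sqrt (p * beta * n%:R) <= (deg G v)%:R) ->
       expander n (p * n%:R / (4 * beta)) G)
  /\
  (forall (d : nat) (lambda : R) (T : finType) (G : sgraph T),
     ndl_graph n d lambda G ->
     lambda < d%:R / 8 ->
     expander n (d%:R / (2 * lambda)) G).
Proof.
split=> [p beta b_gt0 b_le T G | d lambda T G]; last exact: ndl_expander.
exact: bijumbled_expander.
Qed.
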